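(* Let $X$ be a locally ordered space and let $\ast\in X$. In the category of locally ordered spaces, there exists a coequalizer of $i_\ast,c_\ast:S^1\to\overrightarrow{S^1}\times X$ if, and only if, the family of open neighbourhoods of $\ast$ in $X$ has a smallest element (with respect to inclusion). If $O$ is such a smallest open neighbourhood, then $q_O:\overrightarrow{S^1}\times X\to X_O$ is the coequalizer.
   Context: **Locally ordered spaces.** For posets $B,B'$ write $B\subset_{lax}B'$ when $|B|\subset|B'|$ and $p\leq_B q$ implies $p\leq_{B'}q$ for all $p,q\in B$; write $B\subset_{str}B'$ when $|B|\subset |B'|$ and $\leq_B$ is the restriction of $\leq_{B'}$ to $B$. An *ordered basis* on a topological space $X$ is a set $\mathfrak B$ of posets whose underlying sets form a basis of the topology of $X$ and such that for all $x\in X$ and $B,B'\in\mathfrak B$ with $x\in B\cap B'$ there is $B''\in\mathfrak B$ with $x\in B''$, $B''\subset_{lax}B$ and $B''\subset_{lax}B'$. An ordered basis $\mathfrak B'$ is *coarser* than $\mathfrak B$ if for every $x\in X$ and every $B'\in\mathfrak B'$ with $x\in B'$ there is $B\in\mathfrak B$ with $x\in B\subset_{lax}B'$; two ordered bases are *equivalent* if each is coarser than the other. A *locally ordered space* is a topological space with an equivalence class of ordered bases. Its *open posets* are the posets $A$ with $|A|\subset X$ such that for every $x\in A$ there is $B\in\mathfrak B$ with $x\in B\subset_{lax}A$ (for $\mathfrak B$ any basis in the class; this does not depend on the choice); they form the largest ordered basis of the class, denoted $\overrightarrow{\mathcal O}(X)$. **Morphisms.** A map $f:X\to Y$ between locally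 ordered spaces with ordered bases $\mathfrak B,\mathfrak B'$ is *locally increasing at* $x$ if for all $B'\in\mathfrak B'$ with $f(x)\in B'$ there is $B\in\mathfrak B$ with $x\in B$, $f(B)\subset B'$ and $f:B\to B'$ increasing (independent of the bases in the classes). It is locally increasing if it is so at every point. The category of locally ordered spaces has these maps as morphisms. The product $X\times X'$ has ordered basis $\{B\times B'\}$ with product topology and product orders. **Circles.** $S^1=\{z\in\mathbb C:|z|=1\}$. A *proper open arc* is a set $\{e^{ix}: x\in{]a,b[}\}$ with $0<b-a<2\pi$; its standard order is $e^{ix}\leq e^{iy}$ iff $x\leq y$, for $x,y\in{]a,b[}$ (it depends only on the arc $\alpha$ and is written $\leq_\alpha$). The *directed circle* $\overrightarrow{S^1}$ has as ordered basis all proper open arcs with their standard orders. $S^1$, as a locally ordered space, is the *unordered circle*: proper open arcs ordered by equality. **The maps.** $i_\ast(s)=(s,\ast)$ and $c_\ast(s)=(1,\ast)$. **The space $X_O$.** For an open neighbourhood $O$ of $\ast$, let $X_O=O\sqcup (S^1\times(X\setminus O))$ and $q_O:\overrightarrow{S^1}\times X\to X_O$, $q_O(s,t)=t$ if $t\in O$, $q_O(s,t)=(s,t)$ if $t\notin O$. $X_O$ carries the final topology of $q_O$. For a proper open arc $\alpha$ and $A\in\overrightarrow{\mathcal O}(X)$ let $U_{\alpha,A}=q_O(\alpha\times A)=(O\cap A)\sqcup(\alpha\times(A\setminus O))$, ordered by $\leq_{\alpha,A}$, the transitive closure of the image of the product order on $\alpha\times A$ under $q_O$. The posets $(U_{\alpha,A},\leq_{\alpha,A})$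 form the ordered basis that makes $X_O$ a locally ordered space. *)

(* Defs.v *)
From HB Require Import structures.
From Stdlib Require Import Relation_Operators.
From mathcomp Require Import all_boot all_order all_algebra.
From mathcomp Require Import all_classical all_reals all_analysis.
From mathcomp Require Import complex ring lra.

Set Implicit Arguments.
Unset Strict Implicit.
Unset Printing Implicit Defensive.

Import Order.TTheory GRing.Theory Num.Theory numFieldNormedType.Exports.

Local Open Scope classical_set_scope.
Local Open Scope ring_scope.

(* A poset whose underlying set is a subset of T. The order is a relation on T
   that only holds between elements of the subset, so that Leibniz equality of
   subposets is equality of the underlying sets and of the orders. *)
Record subposet (T : Type) := Subposet {
  pcar :> set T ;
  ple : T -> T -> Prop ;
  ple_pcar : forall x y, ple x y -> pcar x /\ pcar y ;
  ple_refl : forall x, pcar x -> ple x x ;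
  ple_anti : forall x y, ple x y -> ple y x -> x = y ;
  ple_trans : forall y x z, ple x y -> ple y z -> ple x z }.

Definition sub_lax {T : Type} (B B' : subposet T) :=
  B `<=` B' /\ forall p q, ple B p q -> ple B' p q.

Section ordered_bases.
Context {T : topologicalType}.
Implicit Types B : set (subposet T).

Definition ordered_basis B :=
  basis [set P : set T | exists2 P' : subposet T, B P' & P = P'] /\
  forall x (P P' : subposet T), B P -> B P' -> pcar P x -> pcar P' x ->
    exists P'' : subposet T, [/\ B P'', pcar P'' x, sub_lax P'' P & sub_lax P'' P'].

Definition coarser B' B :=
  forall x (P' : subposet T), B' P' -> pcar P' x ->
    exists P : subposet T, [/\ B P, pcar P x & sub_lax P P'].

Definition equiv_basis B B' := coarser B B' /\ coarser B' B.

End ordered_bases.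

(* lo_class is a whole equivalence class of ordered bases, not a chosen
   representative. *)
Record lospace := LOSpace {
  lo_top :> topologicalType ;
  lo_class : set (set (subposet lo_top)) ;
  lo_classP : exists2 B, ordered_basis B &
    lo_class = [set B' | ordered_basis B' /\ equiv_basis B B'] }.

Definition open_posets (X : lospace) : set (subposet X) :=
  [set A | forall B, lo_class B -> forall x, pcar A x ->
     exists P : subposet X, [/\ B P, pcar P x & sub_lax P A]].

Definition locally_increasing_at (X Y : topologicalType)
    (B : set (subposet X)) (B' : set (subposet Y)) (f : X -> Y) (x : X) :=
  forall P' : subposet Y, B' P' -> pcar P' (f x) ->
    exists P : subposet X, [/\ B P, pcar P x, f @` P `<=` P' &
      forall p q, ple P p q -> ple P' (f p) (f q)].

(* The condition does not depend on the bases B and B' in the classes, see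
   locally_increasing_indep. *)
Record lomap (X Y : lospace) := LOMap {
  lomap_fun :> X -> Y ;
  lomapP : forall B B', lo_class B -> lo_class B' ->
    forall x, locally_increasing_at B B' lomap_fun x }.
Arguments lomapP {X Y} _ {B B'} _ _ _ [P'] _ _.

Section basic_lemmas.

Lemma sub_lax_refl T (P : subposet T) : sub_lax P P.
Proof. by split. Qed.
Local Hint Resolve sub_lax_refl : core.

Lemma sub_lax_trans T (P Q S : subposet T) :
  sub_lax P Q -> sub_lax Q S -> sub_lax P S.
Proof. by move=> [h1 h2] [h3 h4]; split=> [x /h1/h3//|p q /h2/h4]. Qed.

Lemma coarser_refl (T : topologicalType) (B : set (subposet T)) : coarser B B.
Proof. by move=> x P BP Px; exists P. Qed.

Lemma coarser_trans (T : topologicalType) (B1 B2 B3 : set (subposet T)) :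
  coarser B1 B2 -> coarser B2 B3 -> coarser B1 B3.
Proof.
move=> h12 h23 x P BP Px; have [Q [B2Q Qx QP]] := h12 _ _ BP Px.
have [S [B3S Sx SQ]] := h23 _ _ B2Q Qx.
by exists S; split => //; apply: sub_lax_trans QP.
Qed.

Lemma ordered_basisP (T : topologicalType) (B : set (subposet T)) :
  ordered_basis B <->
  [/\ forall P, B P -> open P,
      forall x (U : set T), open U -> U x ->
        exists P : subposet T, [/\ B P, pcar P x & P `<=` U] &
      forall x (P P' : subposet T), B P -> B P' -> pcar P x -> pcar P' x ->
        exists P'' : subposet T, [/\ B P'', pcar P'' x, sub_lax P'' P & sub_lax P'' P']].
Proof.
split=> [[[h1 h2] h3]|[h1 h2 h3]]; split => //.
- by move=> P BP; apply: h1; exists P.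
- move=> x U oU Ux; have [|V [[P BP PE] Px] VU] := h2 x U.
    exact: open_nbhs_nbhs.
  by exists P; split => //=; rewrite -PE.
- split=> [_ [P BP ->]|x U]; first exact: h1.
  rewrite nbhsE => -[V [oV Vx] VU]; have [P [BP Px PV]] := h2 _ _ oV Vx.
  exists (P : set T); first by split => //; exists P.
  exact: subset_trans VU.
Qed.

Definition lospace_of_basis (T : topologicalType) (B : set (subposet T))
    (hB : ordered_basis B) : lospace :=
  @LOSpace T [set B' | ordered_basis B' /\ equiv_basis B B']
    (ex_intro2 _ _ B hB erefl).

Lemma lo_class_basis (T : topologicalType) (B : set (subposet T))
  (hB : ordered_basis B) : lo_class (l := lospace_of_basis hB) B.
Proof. by split => //; split; exact: coarser_refl. Qed.

Lemma lo_class_ordered (X : lospace) B : lo_class (l := X) B -> ordered_basis B.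
Proof. by have [B0 _ ->] := lo_classP X => -[]. Qed.

Lemma lo_class_coarser (X : lospace) B B' :
  lo_class (l := X) B -> lo_class (l := X) B' -> coarser B B'.
Proof.
have [B0 _ ->] := lo_classP X => -[_ [_ h1]] [_ [h2 _]].
exact: coarser_trans h1 h2.
Qed.

Lemma lo_class_equiv (X : lospace) (B B' : set (subposet X)) :
  lo_class B -> ordered_basis B' -> equiv_basis B B' -> lo_class B'.
Proof.
have [B0 _ ->] := lo_classP X => -[_ [h1 h2]] hB' [h3 h4].
by split=> //; split; [exact: coarser_trans h3|exact: coarser_trans h2].
Qed.

Lemma lo_class_ex (X : lospace) : exists B, lo_class (l := X) B.
Proof.
have [B0 oB0 ->] := lo_classP X.
by exists B0; split => //; split; exact: coarser_refl.
Qed.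

Lemma open_posetsP (X : lospace) B (A : subposet X) : lo_class B ->
  open_posets A <-> forall x, pcar A x ->
     exists P : subposet X, [/\ B P, pcar P x & sub_lax P A].
Proof.
move=> hB; split=> [|h B' hB' x Ax]; first exact.
have [P [BP Px PA]] := h _ Ax.
have [Q [B'Q Qx QP]] := lo_class_coarser hB hB' BP Px.
by exists Q; split => //; apply: sub_lax_trans PA.
Qed.

Lemma lo_class_open_poset (X : lospace) B : lo_class (l := X) B ->
  B `<=` @open_posets X.
Proof. by move=> hB P BP; apply/(open_posetsP _ hB) => x Px; exists P. Qed.

Lemma open_poset_open (X : lospace) (A : subposet X) : open_posets A -> open A.
Proof.
have [B hB] := lo_class_ex X.
have [/(_ _ _)Bo _ _] := (ordered_basisP B).1 (lo_class_ordered hB).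
move=> /(open_posetsP _ hB) h; rewrite openE => x Ax.
have [P [BP Px [PA _]]] := h _ Ax.
by apply: filterS PA _; apply: open_nbhs_nbhs; split => //; exact: Bo.
Qed.

Lemma open_posets_class (X : lospace) : lo_class (@open_posets X).
Proof.
have [B hB] := lo_class_ex X.
have [Bo Bb Bl] := (ordered_basisP B).1 (lo_class_ordered hB).
apply: (lo_class_equiv hB); last first.
  split=> x P; last by move=> /(open_posetsP _ hB); exact.
  by move=> /(lo_class_open_poset hB) hP Px; exists P.
apply/ordered_basisP; split=> [P|x U oU Ux|x P P' oP oP' Px P'x].
- exact: open_poset_open.
- have [P [BP Px PU]] := Bb _ _ oU Ux; exists P; split => //.
  exact: lo_class_open_poset BP.
- have [Q [BQ Qx QP]] := (open_posetsP _ hB).1 oP _ Px.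
  have [Q' [BQ' Q'x QP']] := (open_posetsP _ hB).1 oP' _ P'x.
  have [S [BS Sx SQ SQ']] := Bl _ _ _ BQ BQ' Qx Q'x.
  exists S; split => //; last 2 first.
  + exact: sub_lax_trans QP.
  + exact: sub_lax_trans QP'.
  exact: lo_class_open_poset BS.
Qed.

Lemma locally_increasing_indep (X Y : lospace) B1 B2 B1' B2' (f : X -> Y) x :
  lo_class (l := X) B1 -> lo_class (l := X) B2 ->
  lo_class (l := Y) B1' -> lo_class (l := Y) B2' ->
  locally_increasing_at B1 B1' f x -> locally_increasing_at B2 B2' f x.
Proof.
move=> h1 h2 h1' h2' hf P' B2P' P'x.
have [Q' [B1Q' Q'x [QP1 QP2]]] := lo_class_coarser h2' h1' B2P' P'x.
have [Q [B1Q Qx fQ iQ]] := hf _ B1Q' Q'x.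
have [P [B2P Px [PQ1 PQ2]]] := lo_class_coarser h1 h2 B1Q Qx.
exists P; split => //; last by move=> p q /PQ2/iQ/QP2.
by move=> _ [z Pz <-]; apply: QP1; apply: fQ; exists z => //; exact: PQ1.
Qed.

Definition lomap_of_bases (X Y : lospace) B B' (f : X -> Y)
    (hB : lo_class B) (hB' : lo_class B')
    (hf : forall x, locally_increasing_at B B' f x) : lomap X Y :=
  LOMap (fun B2 B2' h2 h2' x =>
    locally_increasing_indep hB h2 hB' h2' (hf x)).

Lemma lomap_eqP (X Y : lospace) (f g : lomap X Y) : f =1 g -> f = g.
Proof.
case: f g => [f hf] [g hg] /= /funext fg; case: _ / fg hg => hg.
by congr LOMap; exact: Prop_irrelevance.
Qed.

Lemma lo_id_subproof (X : lospace) x :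
  locally_increasing_at (@open_posets X) (@open_posets X) id x.
Proof. by move=> P oP Px; exists P; split => // _ [y Py <-]. Qed.

Lemma lo_comp_subproof (X Y Z : lospace) (g : lomap Y Z) (f : lomap X Y) x :
  locally_increasing_at (@open_posets X) (@open_posets Z) (g \o f) x.
Proof.
have cX := open_posets_class X; have cY := open_posets_class Y.
have cZ := open_posets_class Z.
move=> P oP Pgfx; have [Q [oQ Qfx gQ iQ]] := lomapP g cY cZ _ oP Pgfx.
have [S [oS Sx fS iS]] := lomapP f cX cY _ oQ Qfx.
exists S; split => //; last by move=> p q /iS/iQ.
by move=> _ [y Sy <-]; apply: gQ; exists (f y) => //; apply: fS; exists y.
Qed.

End basic_lemmas.

Definition lo_id (X : lospace) : lomap X X :=
  lomap_of_bases (open_posets_class X) (open_posets_class X)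
    (@lo_id_subproof X).

Definition lo_comp (X Y Z : lospace) (g : lomap Y Z) (f : lomap X Y) :
    lomap X Z :=
  lomap_of_bases (open_posets_class X) (open_posets_class Z)
    (@lo_comp_subproof _ _ _ g f).

Definition is_coequalizer (X Y Q : lospace) (f g : lomap X Y) (q : lomap Y Q) :=
  lo_comp q f = lo_comp q g /\
  forall (Z : lospace) (h : lomap Y Z), lo_comp h f = lo_comp h g ->
    exists! u : lomap Q Z, lo_comp u q = h.

Definition smallest_open_nbhs (T : topologicalType) (x : T) (O : set T) :=
  open_nbhs x O /\ forall U, open_nbhs x U -> O `<=` U.

Section product.

Program Definition prod_poset (T T' : Type) (P : subposet T)
    (P' : subposet T') : subposet (T * T') :=
  @Subposet _ (P `*` P') (fun x y => ple P x.1 y.1 /\ ple P' x.2 y.2) _ _ _ _.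
Next Obligation.
move=> T T' P P' x y [h1 h2].
by have [? ?] := ple_pcar h1; have [? ?] := ple_pcar h2.
Qed.
Next Obligation. by move=> T T' P P' x [? ?]; split; exact: ple_refl. Qed.
Next Obligation.
move=> T T' P P' [x x'] [y y'] /= [h1 h2] [h3 h4].
by rewrite (ple_anti h1 h3) (ple_anti h2 h4).
Qed.
Next Obligation.
move=> T T' P P' y x z [h1 h2] [h3 h4].
by split; [exact: ple_trans h3|exact: ple_trans h4].
Qed.

Definition prod_basis (T T' : Type) (B : set (subposet T))
    (B' : set (subposet T')) : set (subposet (T * T')) :=
  [set prod_poset P P' | P in B & P' in B'].

Lemma prod_poset_lax T T' (P Q : subposet T) (P' Q' : subposet T') :
  sub_lax P Q -> sub_lax P' Q' -> sub_lax (prod_poset P P') (prod_poset Q Q').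
Proof.
move=> [h1 h2] [h3 h4]; split.
  by move=> x [/h1 ? /h3 ?].
by move=> x y [/h2 ? /h4 ?].
Qed.

Lemma prod_basis_ordered (T T' : topologicalType) (B : set (subposet T))
    (B' : set (subposet T')) :
  ordered_basis B -> ordered_basis B' -> ordered_basis (prod_basis B B').
Proof.
move=> /ordered_basisP[Bo Bb Bl] /ordered_basisP[Bo' Bb' Bl'].
apply/ordered_basisP; split.
- move=> _ [P BP [P' BP' <-]]; rewrite openE => -[x x'] [/= Px P'x'].
  exists ((P : set T), (P' : set T')) => //.
  by split; apply: open_nbhs_nbhs; split => //; [exact: Bo|exact: Bo'].
- move=> [x x'] U; rewrite openE => + Ux => /(_ _ Ux) [[V V']] /=.
  rewrite !nbhsE /= => -[[W [oW Wx] WV] [W' [oW' Wx'] WV']] VU.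
  have [P [BP Px PW]] := Bb _ _ oW Wx.
  have [P' [BP' Px' PW']] := Bb' _ _ oW' Wx'.
  exists (prod_poset P P'); split => //; first by exists P => //; exists P'.
  by move=> y [/PW/WV Vy /PW'/WV' V'y]; apply: VU.
- move=> x _ _ [P BP [P' BP' <-]] [Q BQ [Q' BQ' <-]] [Px Px'] [Qx Qx'].
  have [S [BS Sx SP SQ]] := Bl _ _ _ BP BQ Px Qx.
  have [S' [BS' Sx' SP' SQ']] := Bl' _ _ _ BP' BQ' Px' Qx'.
  exists (prod_poset S S'); split => //; first by exists S => //; exists S'.
    exact: prod_poset_lax.
  exact: prod_poset_lax.
Qed.

Lemma prod_basis_coarser (T T' : topologicalType) (B1 B2 : set (subposet T))
    (B1' B2' : set (subposet T')) :
  coarser B1 B2 -> coarser B1' B2' ->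
  coarser (prod_basis B1 B1') (prod_basis B2 B2').
Proof.
move=> h h' x _ [P BP [P' BP' <-]] [Px Px'].
have [Q [BQ Qx QP]] := h _ _ BP Px.
have [Q' [BQ' Qx' QP']] := h' _ _ BP' Px'.
exists (prod_poset Q Q'); split => //; first by exists Q => //; exists Q'.
exact: prod_poset_lax.
Qed.

(* Other bases of X and Y give the same product, see lo_prod_class. *)
Definition lo_prod (X Y : lospace) : lospace :=
  lospace_of_basis (prod_basis_ordered
    (lo_class_ordered (open_posets_class X))
    (lo_class_ordered (open_posets_class Y))).

Lemma lo_prod_class (X Y : lospace) B B' :
  lo_class (l := X) B -> lo_class (l := Y) B' ->
  lo_class (l := lo_prod X Y) (prod_basis B B').
Proof.
move=> hB hB'; have cX := open_posets_class X; have cY := open_posets_class Y.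
split; first by apply: prod_basis_ordered; exact: lo_class_ordered.
by split; apply: prod_basis_coarser; exact: lo_class_coarser.
Qed.

End product.
(* R[i]^o is the type of complex numbers with the topology of its norm. *)
Definition unit_circle (R : realType) : set (R[i]^o)%C := [set z | `|z| = 1].
Arguments unit_circle : clear implicits.

Definition circle (R : realType) : topologicalType := set_type (unit_circle R).

Section circle.
Variable R : realType.
Implicit Types (x y a b : R) (z w : circle R).

Lemma unit_circleE (z : R[i]^o) :
  unit_circle R z <-> complex.Re z ^+ 2 + complex.Im z ^+ 2 = 1.
Proof.
rewrite /unit_circle /= normc_def; split=> [[h]|->]; last by rewrite sqrtr1.
rewrite -[LHS]sqr_sqrtr ?h ?expr1n//.
by rewrite addr_ge0 ?sqr_ge0.
Qed.

Lemma expi_subproof x : ((cos x +i* sin x)%C : R[i]^o) \in unit_circle R.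
Proof. by apply/mem_set/unit_circleE; rewrite /= cos2Dsin2. Qed.

(* expi x is exp(ix). *)
Definition expi x : circle R := exist (fun c : (R[i]^o)%C => c \in unit_circle R) _ (expi_subproof x).

Lemma circle1_subproof : (1 : R[i]^o) \in unit_circle R.
Proof. by apply/mem_set; rewrite /unit_circle /= normr1. Qed.

Definition circle1 : circle R := exist (fun c : (R[i]^o)%C => c \in unit_circle R) _ circle1_subproof.

Let re z : R := complex.Re (val z).
Let im z : R := complex.Im (val z).

Let re_im z : re z ^+ 2 + im z ^+ 2 = 1.
Proof. by apply/unit_circleE; apply: set_mem; exact: valP. Qed.

Let circle_eq z w : re z = re w -> im z = im w -> z = w.
Proof.
rewrite /re /im => h1 h2; apply: val_inj.
by case: (val z) (val w) h1 h2 => [? ?] [? ?] /= -> ->.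
Qed.

Lemma expi_eq1 x : `|x| < pi *+ 2 -> cos x = 1 -> x = 0.
Proof.
move=> xpi cx; apply/eqP; rewrite -normr_eq0; apply/negPn/negP => x0.
have xE : `|x| = (`|x| / 2) *+ 2 by rewrite -mulr_natr; lra.
have : cos `|x| = 1 by rewrite cos_norm.
rewrite xE cos_mulr2n -mulr_natr => h.
have : 0 < sin (`|x| / 2).
  apply: sin_gt0_pi; move: xpi; rewrite -mulr_natr => xpi.
  have : 0 < `|x| by rewrite lt_def x0 normr_ge0.
  lra.
have := cos2Dsin2 (`|x| / 2); nra.
Qed.

Lemma expi_inj x y : `|x - y| < pi *+ 2 -> expi x = expi y -> x = y.
Proof.
move=> xy /(congr1 val) /= [h1 h2]; apply/eqP; rewrite -subr_eq0; apply/eqP.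
apply: expi_eq1 => //; rewrite cosB h1 h2 -!expr2; exact: cos2Dsin2.
Qed.

Lemma expiD x x' t : expi x = expi x' -> expi (x + t) = expi (x' + t).
Proof.
move=> /(congr1 val) /= [h1 h2]; apply: circle_eq; rewrite /re /im /=.
  by rewrite !cosD h1 h2.
by rewrite !sinD h1 h2.
Qed.

Lemma expi_surj m z : exists t,
  [/\ z = expi (m + t), cos t = re z * cos m + im z * sin m & `|t| <= pi].
Proof.
set c := re z * cos m + im z * sin m; set s := im z * cos m - re z * sin m.
have cs : c ^+ 2 + s ^+ 2 = 1.
  have := re_im z; have := cos2Dsin2 m; rewrite /c /s => h1 h2.
  rewrite -[RHS]mulr1 -{1}h1 -h2; ring.
have c1 : -1 <= c <= 1 by apply/andP; nra.
have ct := acosK c1; have st := sin_acos c1.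
have a0 := acos_ge0 c1; have api := acos_lepi c1.
have : exists t, [/\ cos t = c, sin t = s & `|t| <= pi].
  have s2 : `|s| = Num.sqrt (1 - c ^+ 2).
    by rewrite -sqrtr_sqr -cs; congr Num.sqrt; ring.
  case: (leP 0 s) => s0.
    exists (acos c); split => //; last by rewrite ger0_norm.
    by rewrite st -s2 ger0_norm.
  exists (- acos c); rewrite cosN sinN; split => //.
    by rewrite st -s2 ltr0_norm// opprK.
  by rewrite normrN ger0_norm.
move=> [t [ht1 ht2 ht3]]; exists t; split => //.
have h1 := cos2Dsin2 m.
apply: circle_eq.
  have -> : re (expi (m + t)) = cos (m + t) by [].
  rewrite cosD ht1 ht2 /c /s -[LHS]mulr1 -h1; ring.
have -> : im (expi (m + t)) = sin (m + t) by [].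
rewrite sinD ht1 ht2 /c /s -[LHS]mulr1 -h1; ring.
Qed.

Let circle_near (U : set (circle R)) z : open U -> U z ->
  exists2 e : R, 0 < e &
    forall w, `|re w - re z| < e -> `|im w - im z| < e -> U w.
Proof.
move=> [V oV <-] Vz; move: oV; rewrite openE => /(_ _ Vz) /nbhs_ballP [e /= e0].
have eE : e = (complex.Re e)%:C%C by rewrite RRe_real// gtr0_real.
rewrite eE => eV; exists (complex.Re e / 2).
  by move: e0; rewrite eE ltcR => e0; rewrite divr_gt0.
move=> w h1 h2; apply: eV.
have e0' : 0 < complex.Re e by move: e0; rewrite eE ltcR.
rewrite -ball_normE /ball_ /= normc_def ltcR.
rewrite -[ltRHS](@gtr0_norm _ (complex.Re e))// -sqrtr_sqr ltr_sqrt ?exprn_gt0//.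
have -> : complex.Re (val z - val w : R[i]) = - (re w - re z).
  by rewrite /re; case: (val z) (val w) => [? ?] [? ?] /=; ring.
have -> : complex.Im (val z - val w : R[i]) = - (im w - im z).
  by rewrite /im; case: (val z) (val w) => [? ?] [? ?] /=; ring.
rewrite !sqrrN -(real_normK (num_real (re w - re z))).
rewrite -(real_normK (num_real (im w - im z))).
by have := normr_ge0 (re w - re z); have := normr_ge0 (im w - im z); nra.
Qed.

Let open_linear (c s k : R) : `|c| <= 1 -> `|s| <= 1 ->
  open [set z : circle R | k < re z * c + im z * s].
Proof.
move=> c1 s1.
exists [set z : R[i]^o | k < complex.Re z * c + complex.Im z * s]; last by [].
rewrite openE => z /= kz; apply/nbhs_ballP.
set g := complex.Re z * c + complex.Im z * s - k.
have g0 : 0 < g by rewrite subr_gt0.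
exists ((g / 2)%:C)%C; first by rewrite /= ltcR divr_gt0.
move=> w; rewrite -ball_normE /ball_ /= => zw.
have hR : `|complex.Re (z - w : R[i])| < g / 2.
  by rewrite -ltcR; apply: le_lt_trans zw; exact: normc_ge_Re.
have hI : `|complex.Im (z - w : R[i])| < g / 2.
  rewrite -ltcR; apply: le_lt_trans zw.
  rewrite -(normrN (complex.Im _)) -ReiNIm.
  apply: le_trans (normc_ge_Re _) _.
  by rewrite normrM complexiE normCi mulr1.
have eR : complex.Re (z - w : R[i]) = complex.Re z - complex.Re w.
  by case: (z) (w) => [? ?] [? ?].
have eI : complex.Im (z - w : R[i]) = complex.Im z - complex.Im w.
  by case: (z) (w) => [? ?] [? ?].
move: hR hI; rewrite eR eI => hR hI.
have h1 : `|(complex.Re z - complex.Re w) * c| < g / 2.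
  by rewrite normrM; apply: le_lt_trans hR; rewrite ler_piMr.
have h2 : `|(complex.Im z - complex.Im w) * s| < g / 2.
  by rewrite normrM; apply: le_lt_trans hI; rewrite ler_piMr.
have h3 := ler_norm ((complex.Re z - complex.Re w) * c).
have h4 := ler_norm ((complex.Im z - complex.Im w) * s).
move: h1 h2 h3 h4; rewrite /g; lra.
Qed.

Definition arc a b : set (circle R) := expi @` [set x | a < x < b].

Lemma arc_open a b : 0 < b - a < pi *+ 2 -> open (arc a b).
Proof.
rewrite -mulr_natr => /andP[ab0 abpi].
set m := (a + b) / 2; set h := (b - a) / 2.
suff -> : arc a b = [set z | cos h < re z * cos m + im z * sin m].
  by apply: open_linear; [exact: cos_max|exact: sin_max].
have hin : h \in `[0, pi] by rewrite in_itv /=; apply/andP; rewrite /h; lra.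
apply/seteqP; split=> z.
  move=> [x /= /andP[ax xb] <-]; rewrite /re /im /= -cosB -(cos_norm (x - m)).
  have xm : `|x - m| < h by rewrite ltr_norml /m /h; apply/andP; lra.
  by rewrite ltr_cos// in_itv /= normr_ge0 /=; move: xm abpi; rewrite /h; lra.
move=> /=; have [t [-> <- tpi]] := expi_surj m z.
rewrite -(cos_norm t) ltr_cos// ?in_itv /= ?normr_ge0// ltr_norml => /andP[t1 t2].
by exists (m + t) => //=; move: t1 t2; rewrite /m /h => t1 t2; apply/andP; lra.
Qed.

Lemma expi_arc a b x : a < x < b -> arc a b (expi x).
Proof. by move=> h; exists x. Qed.

Lemma small_arc (U : set (circle R)) x (e : R) : open U -> U (expi x) -> 0 < e ->
  exists2 d : R, 0 < d < e & arc (x - d) (x + d) `<=` U.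
Proof.
move=> oU Ux e0; have [r r0 rU] := circle_near oU Ux.
have /cvgrPdist_lt /(_ _ r0) hc := @continuous_cos R x.
have /cvgrPdist_lt /(_ _ r0) hs := @continuous_sin R x.
have : \forall y \near x, U (expi y).
  near=> y; apply: rU; rewrite /re /im /= distrC.
    by near: y.
  by near: y.
move=> /nbhs_ballP [d /= d0 hd]; exists (Num.min d (e / 2)).
  by rewrite lt_min d0 divr_gt0//= gt_min; apply/orP; right; lra.
move=> _ [y /= /andP[h1 h2] <-]; apply: hd.
have h3 : Num.min d (e / 2) <= d by rewrite ge_min lexx.
rewrite -ball_normE /ball_/= ltr_norml; apply/andP; lra.
Unshelve. all: by end_near. Qed.

Lemma arc_inj a b x y : 0 < b - a < pi *+ 2 -> a < x < b -> a < y < b ->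
  expi x = expi y -> x = y.
Proof.
move=> /andP[h1 h2] /andP[h3 h4] /andP[h5 h6]; apply: expi_inj.
by apply: lt_trans h2; rewrite ltr_norml; apply/andP; lra.
Qed.

(* See arc_poset_le for the order in terms of x and y. *)
Program Definition arc_poset a b (ab : 0 < b - a < pi *+ 2) :
    subposet (circle R) :=
  @Subposet _ (arc a b)
    (fun z w => exists x y, [/\ a < x < b, a < y < b, x <= y,
                               z = expi x & w = expi y]) _ _ _ _.
Next Obligation. by move=> a b ab _ _ [x [y [? ? ? -> ->]]]; split; exact: expi_arc. Qed.
Next Obligation. by move=> a b ab _ [x hx <-]; exists x, x. Qed.
Next Obligation.
move=> a b ab z w [x [y [hx hy xy -> ->]]] [y' [x' [hy' hx' yx yE xE]]].
have yy : y = y' by exact: (arc_inj ab).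
have xx : x = x' by exact: (arc_inj ab).
by congr expi; apply/eqP; rewrite eq_le xy yy xx yx.
Qed.
Next Obligation.
move=> a b ab w z v [x [y [hx hy xy -> ->]]] [y' [u [hy' hu yu yE ->]]].
have yy : y = y' by exact: (arc_inj ab).
by exists x, u; split => //; apply: le_trans xy _; rewrite yy.
Qed.

Lemma arc_poset_le a b (ab : 0 < b - a < pi *+ 2) x y :
  a < x < b -> a < y < b -> ple (arc_poset ab) (expi x) (expi y) <-> x <= y.
Proof.
move=> hx hy; split=> [[x' [y' [hx' hy' xy xE yE]]]|xy]; last by exists x, y.
have -> : x = x' by exact: (arc_inj ab).
by have -> : y = y' by exact: (arc_inj ab).
Qed.

Definition dcircle_basis : set (subposet (circle R)) :=
  [set A | exists a b (ab : 0 < b - a < pi *+ 2), A = arc_poset ab].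

Lemma arc_poset_lax x x' d (h : 0 < (x + d) - (x - d) < pi *+ 2) a b
    (ab : 0 < b - a < pi *+ 2) : expi x = expi x' ->
  a <= x' - d -> x' + d <= b -> sub_lax (arc_poset h) (arc_poset ab).
Proof.
move=> xx ad db.
have e y : expi y = expi (x' + (y - x)).
  by rewrite -(expiD _ xx); congr expi; ring.
have i y : x - d < y < x + d -> a < x' + (y - x) < b by move=> /andP[? ?]; apply/andP; split; lra.
split=> [_ [y /i hy <-]|_ _ [y [z [/i hy /i hz yz -> ->]]]].
  by rewrite e; exact: expi_arc.
by exists (x' + (y - x)), (x' + (z - x)); split; rewrite -?e//; lra.
Qed.

Lemma dcircle_ordered : ordered_basis dcircle_basis.
Proof.
apply/ordered_basisP; split.
- by move=> _ [a [b [ab ->]]]; exact: arc_open.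
- move=> z U oU; have [x [-> _ _]] := expi_surj 0 z; rewrite add0r => Ux.
  have [d /andP[d0 dpi] dU] := small_arc oU Ux (pi_gt0 R).
  have h : 0 < (x + d) - (x - d) < pi *+ 2 by rewrite -mulr_natr; lra.
  exists (arc_poset h); split => //; first by exists (x - d), (x + d), h.
  by apply: expi_arc; lra.
- move=> _ _ _ [a [b [ab ->]]] [a' [b' [ab' ->]]] [x hx <-] [x' hx' xE].
  rewrite /= in hx hx'; have p0 := pi_gt0 R.
  pose d := Num.min (Num.min (x - a) (b - x))
     (Num.min (Num.min (x' - a') (b' - x')) (pi / 2)).
  have : [/\ 0 < d, d < pi, d <= x - a, d <= b - x &
             d <= x' - a' /\ d <= b' - x'].
    have dp : d <= pi / 2 by rewrite /d !ge_min lexx !orbT.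
    split; [|lra| | |split].
    + by rewrite /d !lt_min; lra.
    + by rewrite /d !ge_min lexx.
    + by rewrite /d !ge_min lexx !orbT.
    + by rewrite /d !ge_min lexx !orbT.
    + by rewrite /d !ge_min lexx !orbT.
  move=> [d0 dpi d1 d2 [d3 d4]].
  have h : 0 < (x + d) - (x - d) < pi *+ 2 by rewrite -mulr_natr; lra.
  exists (arc_poset h); split; first by exists (x - d), (x + d), h.
  + by apply: expi_arc; lra.
  + by apply: (@arc_poset_lax x x) => //; lra.
  + by apply: (@arc_poset_lax x x') => //; lra.
Qed.

Program Definition discrete_poset (T : Type) (U : set T) : subposet T :=
  @Subposet _ U (fun p q => U p /\ p = q) _ _ _ _.
Next Obligation. by move=> T U x _ [? <-]. Qed.
Next Obligation. by []. Qed.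
Next Obligation. by move=> T U x y [? <-]. Qed.
Next Obligation. by move=> T U y x z [? <-]. Qed.

Definition ucircle_basis : set (subposet (circle R)) :=
  [set A | exists a b, 0 < b - a < pi *+ 2 /\ A = discrete_poset (arc a b)].

Lemma ucircle_ordered : ordered_basis ucircle_basis.
Proof.
have /ordered_basisP[ho hb hl] := dcircle_ordered; apply/ordered_basisP; split.
- by move=> _ [a [b [ab ->]]]; exact: arc_open.
- move=> z U oU Uz; have [_ [[a [b [ab ->]]] Pz PU]] := hb _ _ oU Uz.
  by exists (discrete_poset (arc a b)); split => //; exists a, b.
- move=> z _ _ [a [b [ab ->]]] [a' [b' [ab' ->]]] /= hz hz'.
  have hP : dcircle_basis (arc_poset ab) by exists a, b, ab.
  have hP' : dcircle_basis (arc_poset ab') by exists a', b', ab'.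
  have [_ [[a0 [b0 [ab0 ->]]] Pz [h1 _] [h2 _]]] := hl z _ _ hP hP' hz hz'.
  exists (discrete_poset (arc a0 b0)); split => //; first by exists a0, b0.
  + by split=> // p q [? ?]; split => //; exact: h1.
  + by split=> // p q [? ?]; split => //; exact: h2.
Qed.

End circle.

Definition ucircle (R : realType) : lospace :=
  lospace_of_basis (@ucircle_ordered R).

Definition dcircle (R : realType) : lospace :=
  lospace_of_basis (@dcircle_ordered R).


Section collapse.
Variables (R : realType) (X : lospace) (O : set X).

Definition XO : Type := (set_type O + circle R * set_type (~` O))%type.

HB.instance Definition _ := Choice.on XO.

Definition qO (p : circle R * X) : XO :=
  match pselect (O p.2) with
  | left h => inl (exist _ p.2 (mem_set h))
  | right h => inr (p.1, exist _ p.2 (mem_set (h : (~` O) p.2)))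
  end.

(* the final topology of qO *)
Definition XO_open (U : set XO) := open (qO @^-1` U).

Let XO_openT : XO_open setT.
Proof. exact: openT. Qed.

Let XO_openI : setI_closed XO_open.
Proof. by move=> U V; exact: openI. Qed.

Let XO_open_bigU (I : Type) (f : I -> set XO) :
  (forall i, XO_open (f i)) -> XO_open (\bigcup_i f i).
Proof. by move=> h; apply: bigcup_open => i _; exact: h. Qed.

HB.instance Definition _ :=
  isOpenTopological.Build XO XO_openT XO_openI XO_open_bigU.

Definition XO_rel (al : subposet (circle R)) (A : subposet X) (u v : XO) :=
  exists p p', [/\ ple (prod_poset al A) p p', u = qO p & v = qO p'].

Let snd_XO (u : XO) : X :=
  match u with inl t => val t | inr p => val p.2 end.

Let qO_in (p : circle R * X) (Op : O p.2) :
  exists t : set_type O, val t = p.2 /\ qO p = inl t.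
Proof. by rewrite /qO; case: pselect => // h; exists (exist _ p.2 (mem_set h)). Qed.

Let qO_out (p : circle R * X) (Op : ~ O p.2) :
  exists t : set_type (~` O), val t = p.2 /\ qO p = inr (p.1, t).
Proof.
rewrite /qO; case: pselect => // h.
by exists (exist _ p.2 (mem_set (h : (~` O) p.2))).
Qed.

Let snd_qO p : snd_XO (qO p) = p.2.
Proof. by rewrite /qO; case: pselect. Qed.

Lemma qO_eq p p' : qO p = qO p' -> p.2 = p'.2 /\ (~ O p.2 -> p.1 = p'.1).
Proof.
move=> e; have e2 : p.2 = p'.2 by rewrite -!snd_qO e.
split=> // h; move: e.
have [t [_ ->]] := qO_out h; rewrite e2 in h; have [t' [_ ->]] := qO_out h.
by move=> [].
Qed.

(* A transitive relation that contains XO_rel; antisymmetry is visible on it. *)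
Let XO_le (al : subposet (circle R)) (A : subposet X) (u v : XO) :=
  exists p p', [/\ u = qO p, v = qO p', ple A p.2 p'.2 &
    ~ O p.2 -> ~ O p'.2 ->
      ple al p.1 p'.1 \/ exists t, [/\ O t, ple A p.2 t & ple A t p'.2]].

Let XO_le_rel al A u v :
  clos_trans XO (XO_rel al A) u v -> XO_le al A u v.
Proof.
elim=> [{}u {}v [p [p' [[h1 h2] -> ->]]]|x y z _ [p [p' [-> -> l1 h1]]] _].
  by exists p, p'; split => // _ _; left.
move=> [q [q' [yE -> l2 h2]]]; have [pq2 pq1] := qO_eq yE.
exists p, q'; split => //.
  by apply: ple_trans l1 _; rewrite pq2.
move=> Op Oq'; have [Op'|Op'] := pselect (O p'.2).
  by right; exists p'.2; split => //; rewrite pq2.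
have Oq : ~ O q.2 by rewrite -pq2.
case: (h1 Op Op') => [a1|[t [Ot t1 t2]]]; last first.
  right; exists t; split => //; apply: ple_trans t2 _; by rewrite pq2.
case: (h2 Oq Oq') => [a2|[t [Ot t1 t2]]]; last first.
  by right; exists t; split => //; apply: ple_trans l1 _; rewrite pq2.
by left; apply: ple_trans a1 _; rewrite pq1.
Qed.

Program Definition XO_poset (al : subposet (circle R)) (A : subposet X) :
    subposet XO :=
  @Subposet _ (qO @` prod_poset al A) (clos_trans XO (XO_rel al A)) _ _ _ _.
Next Obligation.
move=> al A u v; elim=> [{}u {}v [p [p' [l -> ->]]]|x y z _ [? _] _ [_ ?]] //.
by have [h h'] := ple_pcar l; split; [exists p|exists p'].
Qed.
Next Obligation.
move=> al A _ [p hp <-]; apply: t_step; exists p, p; split => //.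
exact: ple_refl.
Qed.
Next Obligation.
move=> al A u v /XO_le_rel[p [p' [-> -> l1 h1]]].
move=> /XO_le_rel[q' [q [e' e l2 h2]]].
have [e2 e1] := qO_eq e; have [e2' e1'] := qO_eq e'.
have pp : p.2 = p'.2 by apply: ple_anti l1 _; rewrite e2 e2'.
have [Op|Op] := pselect (O p.2).
  have Op' : O p'.2 by rewrite -pp.
  have [t [tE ->]] := qO_in Op; have [t' [tE' ->]] := qO_in Op'.
  by congr inl; apply: val_inj; rewrite tE tE'.
have Op' : ~ O p'.2 by rewrite -pp.
have nt t : O t -> ple A p.2 t -> ple A t p'.2 -> False.
  rewrite -pp => Ot h h'; apply: Op; by rewrite (ple_anti h h').
case: (h1 Op Op') => [a1|[t [Ot /(nt _ Ot)]]] //.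
rewrite -e2 -e2' -e1// -e1'// in h2.
have a2 : ple al p'.1 p.1.
  case: (h2 Op' Op) => // -[t [Ot]]; rewrite -pp => t1 t2.
  by case: (nt t Ot) => //; rewrite -pp.
have [t [tE ->]] := qO_out Op; have [t' [tE' ->]] := qO_out Op'.
rewrite (ple_anti a1 a2); congr (inr (_, _)).
by apply: val_inj; rewrite tE tE'.
Qed.
Next Obligation. by move=> al A y x z; exact: t_trans. Qed.

Definition XO_basis : set (subposet XO) :=
  [set XO_poset al A | al in @dcircle_basis R & A in @open_posets X].

Let XO_poset_lax al A al' A' :
  sub_lax al al' -> sub_lax A A' -> sub_lax (XO_poset al A) (XO_poset al' A').
Proof.
move=> h h'; have [h1 h2] := prod_poset_lax h h'; split.
  by move=> _ [p /h1 hp <-]; exists p.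
move=> u v /=; elim=> [{}u {}v [p [p' [/h2 l -> ->]]]|x y z _ + _].
  by apply: t_step; exists p, p'.
exact: t_trans.
Qed.

Program Definition inter_poset (A : subposet X) : subposet X :=
  @Subposet _ (A `&` O) (fun x y => [/\ O x, O y & ple A x y]) _ _ _ _.
Next Obligation. by move=> A x y [? ? l]; have [? ?] := ple_pcar l. Qed.
Next Obligation. by move=> A x [? ?]; split => //; exact: ple_refl. Qed.
Next Obligation. by move=> A x y [_ _ l] [_ _]; exact: ple_anti. Qed.
Next Obligation.
by move=> A y x z [? _ l] [_ ? l']; split => //; exact: ple_trans l'.
Qed.

Lemma inter_poset_open (oO : open O) (A : subposet X) :
  open_posets A -> open_posets (inter_poset A).
Proof.
have [B hB] := lo_class_ex X.
have [_ Bb Bl] := (ordered_basisP B).1 (lo_class_ordered hB).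
move=> /(open_posetsP _ hB) h; apply/(open_posetsP _ hB) => x [Ax Ox].
have [P [BP Px PA]] := h _ Ax; have [Q [BQ Qx QO]] := Bb _ _ oO Ox.
have [S [BS Sx [_ SP] [SQ _]]] := Bl _ _ _ BP BQ Px Qx.
have SA p q : ple S p q -> [/\ O p, O q & ple A p q].
  move=> l; have [Sp Sq] := ple_pcar l.
  by split; [exact/QO/SQ|exact/QO/SQ|exact/PA.2/SP].
exists S; split => //; split => // p Sp.
by have [Op _ l] := SA p p (ple_refl Sp); split => //; have [] := ple_pcar l.
Qed.

Let inter_poset_lax A : sub_lax (inter_poset A) A.
Proof. by split=> [x []|p q []]. Qed.

(* Over O the arc does not matter. *)
Lemma XO_poset_inter al al' A s : pcar al' s ->
  sub_lax (XO_poset al (inter_poset A)) (XO_poset al' A).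
Proof.
move=> als.
have qs p : O p.2 -> qO p = qO (s, p.2).
  move=> Op; have [t [tE ->]] := qO_in Op.
  have Op' : O (s, p.2).2 by [].
  have [t' [tE' ->]] := qO_in Op'.
  by congr inl; apply: val_inj; rewrite tE tE'.
split.
  by move=> _ [p [_ [Ap Op]] <-]; exists (s, p.2); rewrite -?qs.
move=> u v /=; elim=> [{}u {}v [p [p' [[l [Op Op' l']] -> ->]]]|x y z _ + _].
  apply: t_step; exists (s, p.2), (s, p'.2); rewrite -!qs//; split => //.
  by split => //; exact: ple_refl.
exact: t_trans.
Qed.

Lemma XO_poset_open (oO : open O) al A : dcircle_basis al -> open_posets A ->
  open (XO_poset al A).
Proof.
move=> hal hA.
have oal : open al.
  exact: (open_poset_open (lo_class_open_poset
    (lo_class_basis (@dcircle_ordered R)) hal)).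
have oA := open_poset_open hA.
have [s als] : exists s, pcar al s.
  move: hal => [a [b [ab ->]]]; exists (expi ((a + b) / 2)).
  by apply: expi_arc; move: ab => /andP[? _]; apply/andP; lra.
rewrite /open /= /XO_open.
suff -> : qO @^-1` (qO @` (al `*` A)) =
    (al `*` A) `|` ([set: circle R] `*` (A `&` O)).
  apply: openU; rewrite openE => -[p p'] [/= hp hp'].
    exists ((al : set (circle R)), (A : set X)) => //.
    by split; apply: open_nbhs_nbhs.
  exists ([set: circle R], A `&` O); last by [].
  split; first exact: filterT.
  by apply: open_nbhs_nbhs; split => //; exact: openI.
apply/seteqP; split=> p.
  move=> [p' [h1 h2] /qO_eq[e2 e1]].
  have [Op|Op] := pselect (O p.2); first by right; do !split => //; rewrite -e2.
  by left; split; [rewrite -e1// e2|rewrite -e2].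
case=> [hp|[_ [Ap Op]]]; first by exists p.
exists (s, p.2); first by [].
have Op' : O (s, p.2).2 by [].
have [t [tE ->]] := qO_in Op; have [t' [tE' ->]] := qO_in Op'.
by congr inl; apply: val_inj; rewrite tE tE'.
Qed.

Lemma XO_ordered : open O -> ordered_basis XO_basis.
Proof.
move=> oO.
have oX := lo_class_ordered (open_posets_class X).
have /ordered_basisP[_ pb _] :=
  prod_basis_ordered (@dcircle_ordered R) oX.
have /ordered_basisP[_ cb cl] := @dcircle_ordered R.
have /ordered_basisP[_ _ Xl] := oX.
have qO_surj u : exists p, u = qO p.
  case: u => [t|[s t]].
    have Ot : O (circle1 R, val t).2 by apply: set_mem; exact: (valP t).
    exists (circle1 R, val t); have [t' [tE ->]] := qO_in Ot.
    by congr inl; apply: val_inj.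
  have Ot : ~ O (s, val t).2.
    by have /set_mem := valP t.
  exists (s, val t); have [t' [tE ->]] := qO_out Ot.
  by congr (inr (_, _)); apply: val_inj.
apply/ordered_basisP; split.
- by move=> _ [al hal [A hA <-]]; exact: XO_poset_open.
- move=> u; have [p ->] := qO_surj u => U oU Up.
  have [_ [[al hal [A hA <-]] Pp PU]] := pb _ _ oU Up.
  exists (XO_poset al A); split; first by exists al => //; exists A.
    by exists p.
  by move=> _ [p' /PU hp' <-].
- move=> u _ _ [al hal [A hA <-]] [al' hal' [A' hA' <-]].
  move=> [p [p1 p2] pu] [p' [p1' p2'] pu'].
  move: pu'; rewrite -pu => /qO_eq[e2 e1].
  rewrite -> e2 in p2'.
  have [A0 [hA0 A0p lA lA']] := Xl _ _ _ hA hA' p2 p2'.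
  have [Op|Op] := pselect (O p.2).
    exists (XO_poset al (inter_poset A0)); split.
    + by exists al => //; exists (inter_poset A0) => //; exact: inter_poset_open.
    + by exists p.
    + apply: XO_poset_lax; [by split|exact: sub_lax_trans lA].
    + apply: sub_lax_trans (XO_poset_inter al A0 p1') _.
      by apply: XO_poset_lax => //; split.
  have ep : p'.1 = p.1 by apply: e1; rewrite e2.
  rewrite -> ep in p1'.
  have [al0 [hal0 al0p lal lal']] := cl _ _ _ hal hal' p1 p1'.
  exists (XO_poset al0 A0); split; first by exists al0 => //; exists A0.
  + by exists p.
  + exact: XO_poset_lax.
  + exact: XO_poset_lax.
Qed.

End collapse.
Arguments XO R {X} O.
Arguments XO_basis R {X} O.

Definition XO_space (R : realType) (X : lospace) (O : set X) (oO : open O) :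
    lospace :=
  lospace_of_basis (@XO_ordered R X O oO).
Arguments XO_space R {X O} oO.

Section maps.
Variables (R : realType) (X : lospace).

Let cylinder := lo_prod (dcircle R) X.

Let cylinder_class : lo_class (l := cylinder)
  (prod_basis (@dcircle_basis R) (@open_posets X)).
Proof.
exact: (lo_prod_class (lo_class_basis (@dcircle_ordered R))
                      (open_posets_class X)).
Qed.

Let ucircle_class : lo_class (l := ucircle R) (@ucircle_basis R).
Proof. exact: lo_class_basis. Qed.

Lemma i_star_subproof (pt : X) s :
  locally_increasing_at (X := circle R) (Y := (circle R * X)%type)
    (@ucircle_basis R)
    (prod_basis (@dcircle_basis R) (@open_posets X)) (fun s => (s, pt)) s.
Proof.
move=> _ [_ [a [b [ab ->]]] [A hA <-]] [/= hs Apt].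
exists (discrete_poset (arc a b)); split => //; first by exists a, b.
- by move=> _ [w hw <-].
- by move=> w _ [hw <-]; split; [exact: (@ple_refl _ (arc_poset ab))|exact: (@ple_refl _ A)].
Qed.

Lemma c_star_subproof (pt : X) s :
  locally_increasing_at (X := circle R) (Y := (circle R * X)%type)
    (@ucircle_basis R)
    (prod_basis (@dcircle_basis R) (@open_posets X))
    (fun=> (circle1 R, pt)) s.
Proof.
move=> P' _ P'1.
have /ordered_basisP[_ cb _] := @ucircle_ordered R.
have [P [hP Ps _]] := cb s setT openT Logic.I.
exists P; split => //; first by move=> _ [w hw <-].
by move=> p q _; exact: (ple_refl P'1).
Qed.

Definition i_star (pt : X) : lomap (ucircle R) cylinder :=
  lomap_of_bases ucircle_class cylinder_class (@i_star_subproof pt).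

Definition c_star (pt : X) : lomap (ucircle R) cylinder :=
  lomap_of_bases ucircle_class cylinder_class (@c_star_subproof pt).

Lemma q_O_subproof (O : set X) (oO : open O) (p : circle R * X) :
  locally_increasing_at (X := (circle R * X)%type) (Y := XO R O)
    (prod_basis (@dcircle_basis R) (@open_posets X)) (XO_basis R O) (@qO R X O) p.
Proof.
move=> _ [al hal [A hA <-]] [p' [p1 p2] /qO_eq[e2 e1]].
have [Op|Op] := pselect (O p.2); last first.
  have Op' : ~ O p'.2 by rewrite e2.
  exists (prod_poset al A); split.
  - by exists al => //; exists A.
  - by split; [rewrite /= -e1|rewrite /= -e2].
  - by move=> _ [u hu <-]; exists u.
  - by move=> u v l; apply: t_step; exists u, v.
have /ordered_basisP[_ cb _] := @dcircle_ordered R.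
have [be [hbe bes _]] := cb p.1 setT openT Logic.I.
have h := @XO_poset_inter R X O be al A _ p1.
have k u v : ple (prod_poset be (inter_poset O A)) u v ->
    ple (XO_poset O al A) (qO O u) (qO O v).
  by move=> l; apply: h.2; apply: t_step; exists u, v.
exists (prod_poset be (inter_poset O A)); split => //.
- by exists be => //; exists (inter_poset O A) => //; exact: inter_poset_open.
- by split => //; split => //; rewrite -e2.
- by move=> _ [u hu <-]; have [] := ple_pcar (k u u (ple_refl hu)).
Qed.

Definition q_O (O : set X) (oO : open O) : lomap cylinder (XO_space R oO) :=
  lomap_of_bases cylinder_class (lo_class_basis (XO_ordered R oO))
    (q_O_subproof oO).

End maps.
Arguments i_star R {X} pt.
Arguments c_star R {X} pt.
Arguments q_O R {X O} oO.

(* Main.v *)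
Require Import Defs.
From HB Require Import structures.
From mathcomp Require Import all_boot all_order all_algebra.
From mathcomp Require Import all_classical all_reals all_analysis.
From mathcomp Require Import lra.

Set Implicit Arguments.
Unset Strict Implicit.
Unset Printing Implicit Defensive.

Import Order.TTheory GRing.Theory Num.Theory numFieldNormedType.Exports.

Local Open Scope classical_set_scope.
Local Open Scope ring_scope.

(** A locally increasing map on the cylinder that is constant on the circle over
    pt is constant on the circles over all points of some open neighbourhood V
    of pt ([collapse_near]). The reason is antisymmetry: near the common value z
    the target is a poset P, compactness of the circle yields V such that all
    circles over V are mapped into P, and each of these circles is then a loop
    that increases in P, hence goes through a single value.

    If O is the smallest open neighbourhood of pt, then V contains O, so every
    map that coequalizes i_star and c_star is constant on the circles over O and
    factors through q_O ([q_O_factor]). The factor map is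
    locally increasing because the order on a basic open set of X_O is generated
    by the image of the order upstairs.

    Conversely, let q be a coequalizer and let V be the neighbourhood obtained
    from q. For every open neighbourhood U of pt, q_U coequalizes the two maps,
    so it factors through q and is constant on the circles over V. But q_U
    collapses only the circles over U ([qO_inside_iff]). Hence V is contained
    in U, and V is the smallest open neighbourhood. *)

(** * Increasing paths *)

(** The step e is the same at every point, so finitely many steps, chained by
    transitivity, lead from u to v. *)
Lemma uniform_locally_increasing (R : realType) (T : Type) (P : subposet T) (g : R -> T)
    (a b e : R) : 0 < e ->
  (forall t, a <= t <= b -> forall v, t <= v < t + e -> ple P (g t) (g v)) ->
  forall u v, a <= u -> u <= v -> v <= b -> ple P (g u) (g v).
Proof.
move=> e0 loc u v au uv vb.
(* Steps of length e / 2 keep each increment strictly inside the allowed e. *)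
have step n : forall u, a <= u -> u <= v -> v < u + n%:R * (e / 2) ->
    ple P (g u) (g v).
  elim: n => [w aw wv|n IH w aw wv vn]; first by rewrite mul0r; lra.
  have wab : a <= w <= b by apply/andP; lra.
  have [vw|wv'] := ltP v (w + e); first by apply: loc => //; rewrite wv.
  apply: (@ple_trans _ P (g (w + e / 2))); first by apply: loc => //; lra.
  by apply: IH; [lra|lra|move: vn; rewrite -natr1 mulrDl mul1r; lra].
have d0 : 0 <= (v - u) / (e / 2) by rewrite divr_ge0; lra.
apply: (step _ _ au uv); rewrite -ltrBlDl -ltr_pdivrMr; last by lra.
exact: archi_boundP.
Qed.

(** * The directed circle *)

Lemma expi0 (R : realType) : expi (0 : R) = circle1 R.
Proof. by apply: val_inj; rewrite /= cos0 sin0. Qed.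

Lemma expi2pi (R : realType) : expi (pi *+ 2 : R) = circle1 R.
Proof. by apply: val_inj; rewrite /= cos2pi sin2pi. Qed.

Lemma expi_pi_neq1 (R : realType) : expi (pi : R) <> circle1 R.
Proof. by move=> /(congr1 val) /= [/eqP]; rewrite cospi; lra. Qed.

(** The order of an arc is read off a lift of the arc to an interval, which need
    not contain the given lift t of the point; this transports it to one around
    t. *)
Lemma dcircle_locally_increasing (R : realType) (al : subposet (circle R)) t :
  dcircle_basis al -> pcar al (expi t) ->
  exists2 d : R, 0 < d & forall u v, t - d < u -> u <= v -> v < t + d ->
    ple al (expi u) (expi v).
Proof.
move=> [a [b [ab ->]]] [x /= hx xE].
pose d := Num.min (x - a) (b - x).
have [d0 d1 d2] : [/\ 0 < d, d <= x - a & d <= b - x].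
  by split; rewrite /d ?lt_min ?ge_min ?lexx ?orbT//; lra.
have h : 0 < (t + d) - (t - d) < pi *+ 2 by lra.
have [_ lax] := @arc_poset_lax R t x d h a b ab (esym xE) ltac:(lra) ltac:(lra).
by exists d => // u v tu uv vt; apply: lax; apply/arc_poset_le; lra.
Qed.

(** * Maps on the cylinder *)

Section cylinder.
Context {R : realType} {X : lospace}.
Implicit Type pt : X.

Let cylinder_class : lo_class (l := lo_prod (dcircle R) X)
  (prod_basis (@dcircle_basis R) (@open_posets X)).
Proof.
exact: (lo_prod_class (lo_class_basis (@dcircle_ordered R))
                      (open_posets_class X)).
Qed.

Lemma cylinder_locally_increasing (Z : lospace)
    (h : lomap (lo_prod (dcircle R) X) Z) (s : circle R) (x : X)
    (P : subposet Z) :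
  open_posets P -> pcar P (h (s, x)) ->
  exists al A, [/\ dcircle_basis al, open_posets A, pcar al s, pcar A x &
    forall p q, ple (prod_poset al A) p q -> ple P (h p) (h q)].
Proof.
move=> oP Ph.
have [_ [[al hal [A hA <-]] [als Ax] _ inc]] :=
  lomapP h cylinder_class (open_posets_class Z) (s, x) oP Ph.
by exists al, A.
Qed.

Lemma coequalizes_starP (Z : lospace) (h : lomap (lo_prod (dcircle R) X) Z) pt :
  lo_comp h (i_star R pt) = lo_comp h (c_star R pt) <->
  forall s, h (s, pt) = h (circle1 R, pt).
Proof.
split=> [e s|e]; last exact: lomap_eqP.
exact: (congr1 (fun k : lomap (ucircle R) Z => k s) e).
Qed.

(** The circle is traversed as the path [expi] on [0, 2 pi]. Compactness of this
    segment gives one neighbourhood of pt and one length of the parameter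
    intervals on which the circles increase, valid at all points, so that the whole
    path increases, from the value at 1 back to the value at 1. *)
Lemma collapse_near (Z : lospace) (h : lomap (lo_prod (dcircle R) X) Z) pt :
  (forall s, h (s, pt) = h (circle1 R, pt)) ->
  exists V, open_nbhs pt V /\
    forall s x, V x -> h (s, x) = h (circle1 R, x).
Proof.
move=> hpt.
have [P [oP Ph]] : exists P : subposet Z, open_posets P /\ pcar P (h (circle1 R, pt)).
  have /ordered_basisP[_ b _] := lo_class_ordered (open_posets_class Z).
  by have [P [? ? _]] := b (h (circle1 R, pt)) setT openT Logic.I; exists P.
(* Pairs i of a point of X and a step length are the indices of the near
   covering argument: inc i t says that the circle over i.1, started at
   t, increases in P for the duration i.2. *)
pose inc (i : X * R) (t : R) :=
  forall v : R, t <= v < t + i.2 -> ple P (h (expi t, i.1)) (h (expi v, i.1)).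
have : \forall i \near filter_prod (nbhs pt) (0 : R)^'+,
    `[0, pi *+ 2]%classic `<=` inc i.
  apply: (compact_near_coveringP _).1; first exact: segment_compact.
  move=> t0 _.
  have Pt : pcar P (h (expi t0, pt)) by rewrite hpt.
  have [al [A [hal hA alt Apt mono]]] := cylinder_locally_increasing oP Pt.
  have [d d0 hd] := dcircle_locally_increasing hal alt.
  have d20 : 0 < d / 2 by lra.
  have nA : nbhs pt A by apply: open_nbhs_nbhs; split => //; exact: open_poset_open.
  have nAd : \forall i \near filter_prod (nbhs pt) (0 : R)^'+,
      pcar A i.1 /\ i.2 < d / 2.
    exists ((A : set X), [set e | e < d / 2]); last by [].
    by split; [exact: nA|exact: nbhs_right_lt].
  near=> t i => v /= /andP[tv vt].
  have t0t : `|t0 - t| < d / 2 by near: t; apply/nbhs_ballP; exists (d / 2).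
  have [Ai i2] : pcar A i.1 /\ i.2 < d / 2 by near: i.
  move: t0t; rewrite ltr_norml => /andP[? ?].
  by apply: mono; split; [apply: hd; lra|exact: ple_refl].
move=> [[V W] /= [nV nW] VW].
move: nV; rewrite nbhsE => -[V' oV' V'V]; exists V'; split => // s x V'x.
have [e e0 We] : exists2 e : R, 0 < e & W e.
  by have [e [? ?]] := filter_ex (filterI nW (nbhs_right_gt (0 : R))); exists e.
have mono := uniform_locally_increasing (P := P) (g := fun t => h (expi t, x))
  (a := 0) (b := pi *+ 2) e0.
have {}mono : forall u v, 0 <= u -> u <= v -> v <= pi *+ 2 ->
    ple P (h (expi u, x)) (h (expi v, x)).
  apply: mono => t ht; apply: (VW (x, e)); first by split => //=; exact: V'V.
  by rewrite /= in_itv.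
have [t [-> _ ht]] := expi_surj pi s.
move: ht; rewrite ler_norml => /andP[? ?].
(* The value at s lies above the value at 0 and below the value at 2 pi. *)
rewrite -expi0; apply: (@ple_anti _ P); last by apply: mono; lra.
by rewrite expi0 -expi2pi; apply: mono; lra.
Unshelve. all: by end_near. Qed.

(** * The quotient X_O *)

Section collapse_map.
Context {O : set X}.

Lemma qO_inside s s' x : O x -> qO O (s, x) = qO O (s', x) :> XO R O.
Proof. by rewrite /qO /=; case: pselect. Qed.

(** Recovering O from its quotient map is what lets q_U detect, in the converse
    direction, which points lie in U. *)
Lemma qO_inside_iff x :
  (forall s, qO O (s, x) = qO O (circle1 R, x) :> XO R O) <-> O x.
Proof.
split=> [e|Ox s]; last exact: qO_inside.
apply: contrapT => nOx; apply: (@expi_pi_neq1 R).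
by have [_ /(_ nOx)] := qO_eq (e (expi pi)).
Qed.

(** A set-theoretic section of qO; the base point 1 over O is arbitrary, since
    the maps composed with it are constant on the circles there. *)
Definition XO_lift (u : XO R O) : circle R * X :=
  match u with inl t => (circle1 R, val t) | inr p => (p.1, val p.2) end.

Lemma XO_liftK : cancel XO_lift (@qO R X O).
Proof.
case=> [t|[s t]]; rewrite /qO /=; case: pselect => h.
- by congr inl; exact: val_inj.
- by case: h; exact/set_mem/(valP t).
- by case: (set_mem (valP t) : ~ O _).
- by congr (inr (_, _)); exact: val_inj.
Qed.

End collapse_map.

Lemma q_O_coequalizes (O : set X) (oO : open O) pt : O pt ->
  lo_comp (q_O R oO) (i_star R pt) = lo_comp (q_O R oO) (c_star R pt).
Proof. by move=> Opt; apply/coequalizes_starP => s; exact: qO_inside. Qed.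

(** For every open O, q_O is the universal map that collapses the circles over
    O. *)
Lemma q_O_factor (O : set X) (oO : open O) (Z : lospace)
    (h : lomap (lo_prod (dcircle R) X) Z) :
  (forall s x, O x -> h (s, x) = h (circle1 R, x)) ->
  exists! u : lomap (XO_space R oO) Z, lo_comp u (q_O R oO) = h.
Proof.
move=> hO; pose k (u : XO R O) := h (XO_lift u).
have kE p : k (qO O p) = h p.
  have [e2 e1] := qO_eq (XO_liftK (qO O p)); rewrite /k.
  case: (XO_lift _) e2 e1 => s x /= -> e1.
  have [Op|nOp] := pselect (O p.2); last by rewrite e1 //; case: p {e1 nOp}.
  by rewrite hO // -(hO p.1) //; case: p {e1 Op}.
have kinc (w : XO_space R oO) :
    locally_increasing_at (X := XO R O) (Y := Z) (XO_basis R O) (@open_posets Z) k w.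
  rewrite -(XO_liftK w); case: (XO_lift w) => s x P oP; rewrite kE => Ph.
  have [al [A [hal hA als Ax mono]]] := cylinder_locally_increasing oP Ph.
  (* The order on U_{al,A} is a transitive closure and P is transitive, so it
     suffices to compare images of comparable pairs of al x A. *)
  have kmono u v : ple (XO_poset O al A) u v -> ple P (k u) (k v).
    elim=> [{}u {}v [p [p' [pp' -> ->]]]|u1 u2 u3 _ + _].
      by rewrite !kE; exact: mono.
    exact: ple_trans.
  exists (XO_poset O al A); split => //.
  - by exists al => //; exists A.
  - by exists (s, x).
  - by move=> _ [u Au <-]; have [] := ple_pcar (kmono u u (ple_refl Au)).
exists (lomap_of_bases (lo_class_basis (XO_ordered R oO)) (open_posets_class Z) kinc).
split=> [|u uE]; first by apply: lomap_eqP => p; exact: kE.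
apply: lomap_eqP => w; rewrite -(XO_liftK w) /= kE -uE //.
Qed.

(** * Coequalizers and smallest neighbourhoods *)

Lemma q_O_is_coequalizer (O : set X) (oO : open O) pt :
  smallest_open_nbhs pt O ->
  is_coequalizer (i_star R pt) (c_star R pt) (q_O R oO).
Proof.
move=> [[_ Opt] minO]; split; first exact: q_O_coequalizes.
move=> Z h /coequalizes_starP /collapse_near [V [oV hV]].
by apply: q_O_factor => s x Ox; apply: hV; exact: minO oV _ Ox.
Qed.

(** A neighbourhood V of pt over which q collapses the circles lies in every open
    neighbourhood U of pt: q_U factors through q, so it collapses the circles
    over V too, and it only does so over U. *)
Lemma coequalizer_smallest_open_nbhs (Q : lospace)
    (q : lomap (lo_prod (dcircle R) X) Q) pt :
  is_coequalizer (i_star R pt) (c_star R pt) q ->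
  exists O : set X, smallest_open_nbhs pt O.
Proof.
move=> [/coequalizes_starP/collapse_near [V [oV qV]] univ].
exists V; split => // U [oU Upt] x Vx.
have [u [uE _]] := univ _ _ (q_O_coequalizes oU Upt).
have qUE p : u (q p) = qO U p.
  exact: (congr1 (fun k : lomap (lo_prod (dcircle R) X) (XO_space R oU) => k p) uE).
by apply/qO_inside_iff => s; rewrite -!qUE qV.
Qed.

End cylinder.

Theorem corollary3p11 (R : realType) (X : lospace) (pt : X) :
  ((exists (Q : lospace) (q : lomap (lo_prod (dcircle R) X) Q),
       is_coequalizer (i_star R pt) (c_star R pt) q) <->
   (exists O : set X, smallest_open_nbhs pt O)) /\
  (forall (O : set X) (oO : open O), smallest_open_nbhs pt O ->
     is_coequalizer (i_star R pt) (c_star R pt) (q_O R oO)).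
Proof.
split; last by move=> O oO; exact: q_O_is_coequalizer.
split=> [[Q [q h]]|[V minV]]; first exact: coequalizer_smallest_open_nbhs h.
have oV : open V by case: minV => -[].
by exists (XO_space R oV), (q_O R oV); exact: q_O_is_coequalizer.
Qed.
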